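(* For every $n\geq 2$, $D_n^{\mathrm{ab}}\cong\mathbb{Z}^{n-1}$. Every generating set of $D_n$ contains at least $n-1$ elements, and $\{d_{2,1},d_{3,2},\ldots,d_{n,n-1}\}$ is a generating set of $D_n$ of minimum cardinality.
   Context: Let $F_n$ be the free group of rank $n\geq 2$ with basis $x_1,\ldots,x_n$. For $1\leq j<i\leq n$, let $d_{i,j}\in\operatorname{Aut}(F_n)$ be the automorphism with $d_{i,j}(x_i)=x_ix_j$ and $d_{i,j}(x_k)=x_k$ for $k\neq i$. Automorphisms are composed as functions: $(\alpha\beta)(x)=\alpha(\beta(x))$. Set $D_n=\langle d_{i,j}\mid 1\leq j<i\leq n\rangle\leq\operatorname{Aut}(F_n)$. For a group $G$, $G^{\mathrm{ab}}=G/G'$ denotes its abelianization. *)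

(* Defs.v *)
From HB Require Import structures.
From mathcomp Require Import all_boot all_order all_algebra.
From mathcomp Require Import boolp classical_sets functions cardinality.

Set Implicit Arguments.
Unset Strict Implicit.
Unset Printing Implicit Defensive.

Local Open Scope group_scope.
Local Open Scope classical_set_scope.

(* The free group on a set [I], as the set of reduced words. The letter       *)
(* [(i, false)] stands for the generator i, and [(i, true)] for its inverse.  *)
Section FreeGroup.
Variable I : choiceType.
Implicit Types (a b : I * bool) (s t : seq (I * bool)).

Definition letterV a : I * bool := (a.1, ~~ a.2).

Definition reduced s := sorted (fun a b => b != letterV a) s.

Record free_group := FreeGroup { word :> seq (I * bool); _ : reduced word }.

HB.instance Definition _ := [isSub for word].
HB.instance Definition _ := [Choice of free_group by <:].

Definition push a s :=
  if s is b :: s' then if b == letterV a then s' else a :: s else [:: a].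

Definition word_mul s t := foldr push t s.
Definition word_inv s := rev (map letterV s).

Lemma letterVK : involutive letterV.
Proof. by case=> i e; rewrite /letterV /= negbK. Qed.

Lemma letterV_neq a : letterV a != a.
Proof. by case: a => i []; rewrite /letterV /= xpair_eqE andbF. Qed.

Lemma reduced_behead a s : reduced (a :: s) -> reduced s.
Proof. exact: path_sorted. Qed.

Lemma reduced_push a s : reduced s -> reduced (push a s).
Proof.
case: s => [//|b s] rs /=; case: ifPn => [_|ba]; first exact: reduced_behead rs.
by rewrite /reduced /= ba.
Qed.

Lemma pushK a s : reduced s -> push (letterV a) (push a s) = s.
Proof.
case: s => [_|b s] /=; first by rewrite letterVK eqxx.
case: eqP => [-> {b}|_ _] /=; last by rewrite letterVK eqxx.
by case: s => [//|c s] /= /andP[/negPf->].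
Qed.

Lemma pushVK a s : reduced s -> push a (push (letterV a) s) = s.
Proof. by move=> rs; rewrite -{1}(letterVK a) pushK. Qed.

Lemma reduced_mul s t : reduced t -> reduced (word_mul s t).
Proof. by move=> rt; elim: s => //= a s; apply: reduced_push. Qed.

Lemma word_mul_push a s t :
  reduced t -> word_mul (push a s) t = push a (word_mul s t).
Proof.
move=> rt; case: s => [//|b s] /=; case: eqP => [->|//].
by rewrite pushVK //; apply: reduced_mul.
Qed.

Lemma word_mulA s t u :
  reduced u -> word_mul s (word_mul t u) = word_mul (word_mul s t) u.
Proof. by move=> ru; elim: s => //= a s ->; rewrite word_mul_push. Qed.

Lemma push_reduced a s : reduced (a :: s) -> push a s = a :: s.
Proof. by case: s => [//|b s] /= /andP[/negPf->]. Qed.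

Lemma word_muls0 s : reduced s -> word_mul s [::] = s.
Proof.
elim: s => //= a s IHs rs; rewrite IHs ?push_reduced //.
exact: reduced_behead rs.
Qed.

Lemma word_mulK s t : reduced t -> word_mul (word_inv s) (word_mul s t) = t.
Proof.
move=> rt; elim: s => //= a s; rewrite /word_inv map_cons rev_cons.
by rewrite /word_mul foldr_rcons pushK //; apply: reduced_mul.
Qed.

Lemma word_invK : involutive word_inv.
Proof.
by move=> s; rewrite /word_inv map_rev revK -map_comp map_id_in // => a _;
  apply: letterVK.
Qed.

Lemma reduced_inv s : reduced s -> reduced (word_inv s).
Proof.
rewrite /reduced /word_inv rev_sorted sorted_map; apply: sub_sorted => a b /=.
by rewrite letterVK eq_sym.
Qed.

Definition free_one : free_group := @FreeGroup [::] isT.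
Definition free_mul (u v : free_group) : free_group :=
  FreeGroup (@reduced_mul u v (valP v)).
Definition free_inv (u : free_group) : free_group :=
  FreeGroup (reduced_inv (valP u)).

Lemma free_mulA : associative free_mul.
Proof. by move=> u v w; apply/val_inj/word_mulA/(valP w). Qed.
Lemma free_mul1g : left_id free_one free_mul.
Proof. by move=> u; apply/val_inj. Qed.
Lemma free_mulg1 : right_id free_one free_mul.
Proof. by move=> u; apply/val_inj/word_muls0/(valP u). Qed.
Lemma free_mulVg : left_inverse free_one free_inv free_mul.
Proof.
move=> u; apply/val_inj; rewrite /= -[X in word_mul _ X]word_muls0 ?(valP u) //.
exact: word_mulK.
Qed.
Lemma free_mulgV : right_inverse free_one free_inv free_mul.
Proof.
move=> u; have {1}-> : u = free_inv (free_inv u); last exact: free_mulVg.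
by apply/val_inj; rewrite /= word_invK.
Qed.

HB.instance Definition _ := isGroup.Build free_group
  free_mulA free_mul1g free_mulg1 free_mulVg free_mulgV.

Definition free_gen (i : I) : free_group := @FreeGroup [:: (i, false)] isT.

(* Universal property: [free_lift f] is the unique homomorphism extending f.  *)
Section Lift.
Variables (G : groupType) (f : I -> G).

Definition free_lift (u : free_group) : G :=
  \prod_(a <- word u) (if a.2 then (f a.1)^-1 else f a.1).

Lemma free_liftM : {morph free_lift : u v / u * v}.
Proof.
move=> [s rs] [t rt]; rewrite /free_lift /= {rs rt}.
elim: s => [|a s IHs] /=; first by rewrite big_nil mul1g.
rewrite big_cons -mulgA -IHs; case: (word_mul s t) => [|b w] /=.
  by rewrite big_cons big_nil.
case: eqP => [->|_]; last by rewrite big_cons.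
by rewrite big_cons /=; case: a.2; rewrite /= ?mulKg ?mulVKg.
Qed.

Lemma free_lift1 : free_lift 1 = 1.
Proof. by rewrite /free_lift big_nil. Qed.

HB.instance Definition _ := isUMagmaMorphism.Build free_group G
  free_lift (free_lift1, free_liftM).

Lemma free_lift_gen i : free_lift (free_gen i) = f i.
Proof. by rewrite /free_lift big_seq1. Qed.

End Lift.

Lemma free_hom_eq (G : groupType) (g h : free_group -> G) :
    {morph g : u v / u * v} -> {morph h : u v / u * v} ->
  (forall i, g (free_gen i) = h (free_gen i)) -> g =1 h.
Proof.
move=> gM hM gh.
have g1 : g 1 = 1 by apply: (mulgI (g 1)); rewrite -gM !mulg1.
have h1 : h 1 = 1 by apply: (mulgI (h 1)); rewrite -hM !mulg1.
have gV u : g u^-1 = (g u)^-1 by apply/esym/mulg1_eq; rewrite -gM mulgV.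
have hV u : h u^-1 = (h u)^-1 by apply/esym/mulg1_eq; rewrite -hM mulgV.
have gha a : g (@FreeGroup [:: a] isT) = h (@FreeGroup [:: a] isT).
  case: a => i []; last exact: gh.
  have -> : @FreeGroup [:: (i, true)] isT = (free_gen i)^-1 by apply/val_inj.
  by rewrite gV hV gh.
case; elim=> [|a s IHs] rs.
  by have -> : FreeGroup rs = 1 by [apply/val_inj]; rewrite g1 h1.
have rs' := reduced_behead rs.
have -> : FreeGroup rs = @FreeGroup [:: a] isT * FreeGroup rs'.
  by apply/val_inj; rewrite /= push_reduced.
by rewrite gM hM gha IHs.
Qed.

End FreeGroup.

(* Aut(G), with [(a * b) x = a (b x)]. The inverse map carried by the record  *)
(* is determined by the automorphism, see [aut_eq].                           *)
Section Automorphisms.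
Variable G : groupType.

Record aut := Aut {
  aut_fun :> G -> G;
  aut_inv : G -> G;
  autM : {morph aut_fun : x y / x * y};
  autK : cancel aut_fun aut_inv;
  autVK : cancel aut_inv aut_fun }.

Lemma aut_eq (a b : aut) : a =1 b -> a = b.
Proof.
case: a b => [f f' fM fK fVK] [g g' gM gK gVK] /= /funext fg.
rewrite {f}fg in fM fK fVK *.
have f'g' : f' = g' by apply/funext => x; rewrite -{1}(gVK x) fK.
rewrite {f'}f'g' in fK fVK *.
by congr Aut; apply: Prop_irrelevance.
Qed.

HB.instance Definition _ := gen_eqMixin aut.
HB.instance Definition _ := gen_choiceMixin aut.

Definition aut_one : aut :=
  @Aut id id (fun _ _ => erefl) (fun _ => erefl) (fun _ => erefl).

Lemma aut_mulM (a b : aut) : {morph a \o b : x y / x * y}.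
Proof. by move=> x y /=; rewrite !autM. Qed.

Definition aut_mul (a b : aut) : aut :=
  Aut (aut_mulM a b) (can_comp (@autK a) (@autK b))
      (can_comp (@autVK b) (@autVK a)).

Lemma aut_invM (a : aut) : {morph aut_inv a : x y / x * y}.
Proof. by move=> x y; apply: (can_inj (@autK a)); rewrite autM !autVK. Qed.

Definition aut_opp (a : aut) : aut := Aut (@aut_invM a) (@autVK a) (@autK a).

Lemma aut_mulA : associative aut_mul.
Proof. by move=> a b c; apply: aut_eq. Qed.
Lemma aut_mul1g : left_id aut_one aut_mul.
Proof. by move=> a; apply: aut_eq. Qed.
Lemma aut_mulg1 : right_id aut_one aut_mul.
Proof. by move=> a; apply: aut_eq. Qed.
Lemma aut_mulVg : left_inverse aut_one aut_opp aut_mul.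
Proof. by move=> a; apply: aut_eq => x; apply: autK. Qed.
Lemma aut_mulgV : right_inverse aut_one aut_opp aut_mul.
Proof. by move=> a; apply: aut_eq => x; apply: autVK. Qed.

HB.instance Definition _ := isGroup.Build aut
  aut_mulA aut_mul1g aut_mulg1 aut_mulVg aut_mulgV.

End Automorphisms.

Section Subgroups.
Variable G : groupType.

Definition generated (S : set G) : set G :=
  smallest (fun H : set G => group_closed [in H]) S.

Lemma generated_closed (S : set G) : group_closed [in generated S].
Proof.
split=> [|x y].
  by rewrite inE => H [[H1 _] _]; move: H1; rewrite inE.
rewrite !inE => Sx Sy H HP; have [[_ HF] _] := HP.
by have := HF x y; rewrite !inE; apply; [apply: Sx|apply: Sy].
Qed.

Definition generated_group (S : set G) : Type := set_type (generated S).

HB.instance Definition _ (S : set G) := SubChoice.on (generated_group S).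
HB.instance Definition _ (S : set G) :=
  SubChoice_isSubGroup.Build G [in generated S] (generated_group S)
    (generated_closed S).

End Subgroups.

Section Abelianization.
Variable G : groupType.

Definition derived : set G :=
  generated [set z | exists x y : G, z = [~ x, y]].

Definition derived_eq (x y : G) : bool := `[< derived (x^-1 * y) >].

Lemma derived1 : derived 1.
Proof. by have [] := generated_closed [set z | exists x y : G, z = [~ x, y]];
  rewrite inE. Qed.

Lemma derivedM (x y : G) : derived x -> derived y -> derived (x * y).
Proof.
have /group_closedM := generated_closed [set z | exists x y : G, z = [~ x, y]].
by move=> cM Dx Dy; have := cM x y; rewrite !inE; apply.
Qed.

Lemma derivedV (x : G) : derived x -> derived x^-1.
Proof.
have /group_closedV := generated_closed [set z | exists x y : G, z = [~ x, y]].
by move=> cV Dx; have := cV x; rewrite !inE; apply.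
Qed.

Lemma derivedR (x y : G) : derived [~ x, y].
Proof. by apply: sub_gen_smallest; exists x, y. Qed.

Lemma derivedJ (x y : G) : derived x -> derived (x ^ y).
Proof.
move=> Dx; have -> : x ^ y = x * [~ x, y] by rewrite commgEl mulVKg.
by apply: derivedM => //; apply: derivedR.
Qed.

Lemma derived_eq_refl : reflexive derived_eq.
Proof. by move=> x; apply/asboolP; rewrite mulVg; apply: derived1. Qed.

Lemma derived_eq_sym : symmetric derived_eq.
Proof.
by move=> x y; apply/asboolP/asboolP => /derivedV; rewrite invgM invgK.
Qed.

Lemma derived_eq_trans : transitive derived_eq.
Proof.
move=> y x z /asboolP Dxy /asboolP Dyz; apply/asboolP.
by have := derivedM Dxy Dyz; rewrite -mulgA mulVKg.
Qed.

Canonical derived_equiv :=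
  EquivRel derived_eq derived_eq_refl derived_eq_sym derived_eq_trans.

Definition abelianization : Type := {eq_quot derived_equiv}%qT.

HB.instance Definition _ := Choice.on abelianization.
HB.instance Definition _ := EqQuotient.on abelianization.

Local Open Scope quotient_scope.

Definition ab_one : abelianization := \pi_abelianization 1.
Definition ab_mul (x y : abelianization) : abelianization :=
  \pi_abelianization (repr x * repr y).
Definition ab_inv (x : abelianization) : abelianization :=
  \pi_abelianization (repr x)^-1.

Lemma ab_piP (x y : G) :
  reflect (\pi_abelianization x = \pi_abelianization y) (derived_eq x y).
Proof. exact: (@eqmodP _ derived_equiv). Qed.

Lemma ab_reprP (x : G) : derived (x^-1 * repr (\pi_abelianization x)).
Proof. by apply/asboolP/ab_piP; rewrite reprK. Qed.

Lemma ab_piM (x y : G) :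
  \pi_abelianization (x * y) = ab_mul (\pi_abelianization x) (\pi_abelianization y).
Proof.
apply/ab_piP/asboolP; have Dx := ab_reprP x; have Dy := ab_reprP y.
set x' := repr _ in Dx *; set y' := repr _ in Dy *.
have -> : (x * y)^-1 * (x' * y') = (x^-1 * x') ^ y * (y^-1 * y').
  by rewrite invgM conjgE -!mulgA mulVKg.
by apply: derivedM => //; apply: derivedJ.
Qed.

Lemma ab_piV (x : G) : \pi_abelianization x^-1 = ab_inv (\pi_abelianization x).
Proof.
apply/ab_piP/asboolP; have := ab_reprP x; set x' := repr _ => Dx.
have -> : x^-1^-1 * x'^-1 = (x^-1 * x')^-1 ^ x^-1.
  by rewrite conjgE !invgM !invgK -!mulgA mulgV mulg1.
by apply: derivedJ; apply: derivedV.
Qed.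

Lemma ab_mulA : associative ab_mul.
Proof.
elim/quotW=> x; elim/quotW=> y; elim/quotW=> z.
by rewrite -(ab_piM y z) -(ab_piM x (y * z)) -(ab_piM x y) -ab_piM mulgA.
Qed.
Lemma ab_mul1g : left_id ab_one ab_mul.
Proof. by elim/quotW=> x; rewrite -(ab_piM 1 x) mul1g. Qed.
Lemma ab_mulg1 : right_id ab_one ab_mul.
Proof. by elim/quotW=> x; rewrite -(ab_piM x 1) mulg1. Qed.
Lemma ab_mulVg : left_inverse ab_one ab_inv ab_mul.
Proof. by elim/quotW=> x; rewrite -(ab_piV x) -(ab_piM x^-1 x) mulVg. Qed.
Lemma ab_mulgV : right_inverse ab_one ab_inv ab_mul.
Proof. by elim/quotW=> x; rewrite -(ab_piV x) -(ab_piM x x^-1) mulgV. Qed.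

HB.instance Definition _ := isGroup.Build abelianization
  ab_mulA ab_mul1g ab_mulg1 ab_mulVg ab_mulgV.

End Abelianization.

Definition isomorphic (G H : groupType) : Prop :=
  exists f : {multiplicative G -> H}, bijective f.

(* The basis x_1, ..., x_n of F_n is indexed from 0, by ['I_n].               *)
Section LowerTriangular.
Variable n : nat.

Local Notation F := (free_group 'I_n).
Local Notation x := (@free_gen 'I_n).

Section Transvection.
Variables (i j : 'I_n) (lt_ji : (j < i)%N).

Definition d_fun : F -> F :=
  free_lift (fun k => if k == i then x i * x j else x k).
Definition d_inv : F -> F :=
  free_lift (fun k => if k == i then x i * (x j)^-1 else x k).

Let neq_ji : (j == i) = false.
Proof. by have:= lt_ji; rewrite ltn_neqAle => /andP[/negPf]. Qed.

Lemma d_funK : cancel d_fun d_inv.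
Proof.
apply: (@free_hom_eq _ _ (d_inv \o d_fun) id) => // [u v|k] /=.
  by rewrite /d_fun /d_inv !gmulfM.
rewrite /d_fun free_lift_gen; case: eqP => [->|/eqP/negPf ki].
  by rewrite /d_inv free_liftM !free_lift_gen eqxx neq_ji mulgVK.
by rewrite /d_inv free_lift_gen ki.
Qed.

Lemma d_invK : cancel d_inv d_fun.
Proof.
apply: (@free_hom_eq _ _ (d_fun \o d_inv) id) => // [u v|k] /=.
  by rewrite /d_fun /d_inv !gmulfM.
rewrite /d_inv free_lift_gen; case: eqP => [->|/eqP/negPf ki].
  by rewrite /d_fun free_liftM gmulfV /= !free_lift_gen eqxx neq_ji mulgK.
by rewrite /d_fun free_lift_gen ki.
Qed.

Definition d_aut : aut F := Aut (@free_liftM _ _ _) d_funK d_invK.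

Lemma d_autE (k : 'I_n) : d_aut (x k) = if k == i then x i * x j else x k.
Proof. exact: free_lift_gen. Qed.

End Transvection.

Definition d_gens : set (aut F) :=
  [set a | exists (i j : 'I_n) (lt_ji : (j < i)%N), a = d_aut lt_ji].

Definition D : set (aut F) := generated d_gens.
Definition D_group : groupType := generated_group d_gens.

(* {d_{2,1}, d_{3,2}, ..., d_{n,n-1}} *)
Definition d_consecutive : set (aut F) :=
  [set a | exists (i j : 'I_n) (lt_ji : (j < i)%N),
             i = j.+1 :> nat /\ a = d_aut lt_ji].

(* As S `<=` generated S, such an S is automatically a subset of D.           *)
Definition generates_D (S : set (aut F)) : Prop := generated S = D.

End LowerTriangular.

(* Main.v *)
From HB Require Import structures.
Require Import Defs.
From mathcomp Require Import all_boot all_order all_algebra.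
From mathcomp Require Import boolp classical_sets functions cardinality.

(** The automorphism [d_{i,j}] acts on the abelianization [Z^n] of [F_n] by a
    lower unitriangular matrix, and hence so does every element of [D_n]. Write
    such a matrix as [1 + N] with [N] strictly lower triangular. In
    [(1 + N)(1 + P) = 1 + N + P + N P] the product [N P] vanishes on the
    subdiagonal as well, so reading off the subdiagonal of [N] is a homomorphism
    [D_n -> Z^(n-1)] ([subdiagM]). It sends the consecutive generators
    [d_{2,1}, ..., d_{n,n-1}] to the standard basis ([subdiag_gen]).

    On the other hand the consecutive generators generate [D_n]: for [k < j < i],
    [d_{i,k}] is the commutator of [d_{i,j}] and the inverse of [d_{j,k}]
    ([d_commutator]), so the non-consecutive generators are obtained by induction
    ([consecutive_generate]).

    The rest holds for any group [G] generated by [e_1, ..., e_m] with a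
    homomorphism [psi : G -> Z^m] sending [e_i] to the i-th basis vector. Since
    the classes of the [e_i] generate the abelianization, the map from [Z^m]
    sending the basis to these classes is onto, and [psi] inverts it
    ([abelianization_free]). And if [S] generates [G], the vectors [psi s] with
    [s] in [S] span [Q^m], so there are at least [m] of them
    ([generators_card]). *)

Set Implicit Arguments.
Unset Strict Implicit.
Unset Printing Implicit Defensive.

Import GRing.Theory.

Local Open Scope classical_set_scope.
Local Open Scope card_scope.
Local Open Scope ring_scope.

(** * Generated subgroups *)

Section Generated.
Variables (G : groupType) (S : set G).

Lemma generated_min (H : set G) :
  group_closed [in H] -> S `<=` H -> generated S `<=` H.
Proof. by move=> cH SH; apply: smallest_sub. Qed.

Lemma generated1 : generated S 1%g.
Proof. by have [] := generated_closed S; rewrite inE. Qed.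

Lemma generatedF x y : generated S x -> generated S y -> generated S (x / y)%g.
Proof.
have [_ cF] := generated_closed S => Sx Sy.
by have := cF x y; rewrite !inE; apply.
Qed.

Lemma generatedV x : generated S x -> generated S x^-1%g.
Proof.
by move=> Sx; rewrite -[x^-1%g]mul1g; apply: generatedF Sx; apply: generated1.
Qed.

Lemma generatedM x y : generated S x -> generated S y -> generated S (x * y)%g.
Proof.
by move=> Sx Sy; rewrite -[y]invgK; apply: generatedF => //; apply: generatedV.
Qed.

Lemma generated_ind (H : G -> Prop) :
    H 1%g -> (forall x y, H x -> H y -> H (x / y)%g) -> (forall x, S x -> H x) ->
  forall x, generated S x -> H x.
Proof.
move=> H1 HF SH; apply: (@generated_min H) => //.
by split=> [|x y]; rewrite !inE; [exact: H1|exact: HF].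
Qed.

End Generated.

(** Passes from generation inside an ambient group, as in [generates_D], to
    generation of the subgroup seen as a group of its own. *)
Lemma generated_preimage (G : groupType) (S T : set G) :
  generated T = generated S ->
  generated [set x : generated_group S | T (val x)] = setT.
Proof.
move=> TS; apply/seteqP; split=> // x _; set T' := (X in generated X).
suff ind y : generated T y ->
    exists2 z : generated_group S, val z = y & generated T' z.
  have [|z /val_inj <- //] := ind (val x).
  by rewrite TS; apply/set_mem/(valP x).
elim/generated_ind: y / => [|y z [y' <- Ty'] [z' <- Tz']|y Ty].
- by exists 1%g; [|apply: generated1].
- by exists (y' / z')%g; [rewrite gmulfF|apply: generatedF].
have Sy : y \in generated S by rewrite inE -TS; apply: sub_gen_smallest.
by exists (SigSub Sy); [|apply: sub_gen_smallest].
Qed.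

(** * Groups with a homomorphism onto Z^m splitting over m generators *)

Section AdditiveAbelianization.
Variable G : groupType.
Local Open Scope quotient_scope.

(** The group law of [abelianization] is multiplicative; the alias carries it as
    a [zmodType], for integer multiples and finite sums. *)
Definition ab_zmod : Type := abelianization G.
HB.instance Definition _ := Choice.on ab_zmod.

Lemma ab_mulC : commutative (@ab_mul G).
Proof.
elim/quotW=> x; elim/quotW=> y; rewrite -[LHS]ab_piM -[RHS]ab_piM.
apply/ab_piP/asboolP.
have -> : ((x * y)^-1 * (y * x) = [~ y, x])%g.
  by rewrite /commg conjgE !invgM !mulgA.
exact: derivedR.
Qed.

HB.instance Definition _ := GRing.isZmodule.Build ab_zmod
  (@ab_mulA G) ab_mulC (@ab_mul1g G) (@ab_mulVg G).

Definition ab_pi (x : G) : ab_zmod := \pi_(abelianization G) x.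

Lemma ab_zmodW (P : ab_zmod -> Prop) : (forall x, P (ab_pi x)) -> forall q, P q.
Proof. by move=> Ppi; elim/quotW. Qed.

Lemma ab_piD x y : ab_pi (x * y)%g = ab_pi x + ab_pi y.
Proof. exact: ab_piM. Qed.

Lemma ab_piB x y : ab_pi (x / y)%g = ab_pi x - ab_pi y.
Proof. by apply: (addIr (ab_pi y)); rewrite -ab_piD divgK subrK. Qed.

End AdditiveAbelianization.

Section HomToFree.
Variables (G : groupType) (m : nat) (psi : G -> 'rV[int]_m) (e : 'I_m -> G).
Hypothesis psiM : forall x y, psi (x * y)%g = psi x + psi y.
Hypothesis psie : forall i, psi (e i) = delta_mx 0 i.

Let psi1 : psi 1%g = 0.
Proof. by apply: (addrI (psi 1%g)); rewrite -psiM mulg1 addr0. Qed.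

Let psiF x y : psi (x / y)%g = psi x - psi y.
Proof. by apply: (addIr (psi y)); rewrite -psiM divgK subrK. Qed.

(** The matrix with rows [psi s], for [s] in a finite generating set, has a row
    space over [Q] that contains the image of [psi], hence the standard basis;
    its rank [m] is at most its number of rows. *)
Lemma generators_card (S : set G) : generated S = setT -> `I_m #<= S.
Proof.
move=> genS.
have [/finite_seqP[s0 S_s0]|infS] := pselect (finite_set S); last first.
  apply: card_le_trans (subset_card_le (@subsetT _ `I_m)) _.
  exact/infiniteP.
pose s := undup s0.
have sS x : (x \in s) = (x \in S).
  by rewrite mem_undup S_s0; apply/idP/idP; rewrite inE.
have inj_s : {in `I_(size s) &, injective (nth 1%g s)}.
  move=> i j /set_mem /= lti /set_mem /= ltj /eqP.
  by rewrite nth_uniq ?undup_uniq // => /eqP.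
have le_sS : `I_(size s) #<= S.
  rewrite -(card_le_eql (inj_card_eq inj_s)); apply: subset_card_le.
  by move=> _ [i /= lti <-]; apply/set_mem; rewrite -sS mem_nth.
apply: card_le_trans le_sS; rewrite card_le_II.
pose A : 'M[rat]_(size s, m) :=
  \matrix_(i < size s) map_mx intr (psi (nth 1%g s i)).
have psiA x : (map_mx intr (psi x) <= A)%MS.
  have: generated S x by rewrite genS.
  elim/generated_ind: x / => [|x y Ax Ay|x].
  - by rewrite psi1 map_mx0 sub0mx.
  - by rewrite psiF map_mxB addmx_sub ?eqmx_opp.
  - move/mem_set; rewrite -sS => s_x.
    have lt_x : (index x s < size s)%N by rewrite index_mem.
    have -> : map_mx intr (psi x) = row (Ordinal lt_x) A.
      by rewrite rowK /= nth_index.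
    exact: row_sub.
have: (1%:M <= A)%MS.
  apply/row_subP => i; rewrite row1 -(map_delta_mx intr) -psie; exact: psiA.
by move/mxrankS; rewrite mxrank1 => /leq_trans->; rewrite // rank_leq_row.
Qed.

Hypothesis gen_e : generated (range e) = setT.

Lemma psi_derived x : derived x -> psi x = 0.
Proof.
elim/generated_ind: x / => [|x y x0 y0|_ [x [y ->]]] //.
  by rewrite psiF x0 y0 subrr.
by apply: (addrI (psi (y * x)%g)); rewrite -psiM -commgC addr0 !psiM addrC.
Qed.

Definition ab_lift (q : ab_zmod G) : 'rV[int]_m := psi (repr (q : abelianization G)).

Lemma ab_liftE x : ab_lift (ab_pi x) = psi x.
Proof.
apply/eqP; rewrite -subr_eq0 -(addrC (- _)); apply/eqP.
have psiV : psi x^-1%g = - psi x by rewrite -[x^-1%g]mul1g psiF psi1 sub0r.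
by rewrite -psiV -psiM; apply: psi_derived; apply: ab_reprP.
Qed.

Lemma ab_liftD : nmod_morphism ab_lift.
Proof.
split; first by rewrite -[LHS]/(ab_lift (ab_pi 1%g)) ab_liftE psi1.
elim/ab_zmodW=> x; elim/ab_zmodW=> y.
by rewrite -[X in ab_lift X](ab_piD x y) !ab_liftE psiM.
Qed.
HB.instance Definition _ := GRing.isNmodMorphism.Build _ _ ab_lift ab_liftD.

Definition ab_comb (v : 'rV[int]_m) : ab_zmod G := \sum_i ab_pi (e i) *~ v 0 i.

Lemma ab_combB : zmod_morphism ab_comb.
Proof.
move=> u v; rewrite /ab_comb -sumrB; apply: eq_bigr => i _.
by rewrite !mxE mulrzBr.
Qed.
HB.instance Definition _ := GRing.isZmodMorphism.Build _ _ ab_comb ab_combB.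

(** Both sides are homomorphisms in [x], so it is enough that they agree on the
    generators [e i]; this is where the injectivity of [ab_lift] comes from. *)
Lemma ab_comb_psi x : ab_comb (psi x) = ab_pi x.
Proof.
have: generated (range e) x by rewrite gen_e.
elim/generated_ind: x / => [|x y IHx IHy|_ [i _ <-]].
- by rewrite psi1 raddf0.
- by rewrite psiF raddfB /= IHx IHy ab_piB.
rewrite psie /ab_comb (bigD1 i) //= mxE !eqxx mulr1z big1 ?addr0 // => j.
by move=> /negPf ji; rewrite mxE ji andbF mulr0z.
Qed.

Lemma ab_combK : cancel ab_comb ab_lift.
Proof.
move=> v; rewrite /ab_comb raddf_sum [RHS]row_sum_delta; apply: eq_bigr => i _.
by rewrite raddfMz /= ab_liftE psie -scaler_int intz.
Qed.

Lemma abelianization_free :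
  isomorphic (abelianization G) (Algebra.to_multiplicative 'rV[int]_m).
Proof.
pose Zm := Algebra.to_multiplicative 'rV[int]_m.
pose fM := isMultiplicative.Build (abelianization G) Zm ab_lift ab_liftD.2.
pose f : {multiplicative _ -> _} :=
  HB.pack (ab_lift : abelianization G -> Zm) fM.
exists f; exists ab_comb => [|v]; last exact: ab_combK.
by elim/ab_zmodW=> x; rewrite /f /= ab_liftE ab_comb_psi.
Qed.

End HomToFree.

(** * The action on the abelianization of the free group *)

Section FreeGroupAction.
Variable n : nat.
Local Notation F := (free_group 'I_n).
Local Notation x := (@free_gen 'I_n).
Local Notation Zn := (Algebra.to_multiplicative 'rV[int]_n).

Definition exponents (u : F) : 'rV[int]_n := free_lift (delta_mx 0 : 'I_n -> Zn) u.

Lemma exponentsM u v : exponents (u * v)%g = exponents u + exponents v.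
Proof. exact: (free_liftM (delta_mx 0 : 'I_n -> Zn)). Qed.

Lemma exponents_gen k : exponents (x k) = delta_mx 0 k.
Proof. exact: (@free_lift_gen _ Zn). Qed.

Lemma exponentsV u : exponents u^-1%g = - exponents u.
Proof.
apply: (addIr (exponents u)).
by rewrite -exponentsM mulVg addNr /exponents free_lift1.
Qed.

Definition action_mx (a : aut F) : 'M[int]_n := \matrix_k exponents (a (x k)).

Lemma exponents_aut (a : aut F) u : exponents (a u) = exponents u *m action_mx a.
Proof.
apply: (@free_hom_eq _ Zn (exponents \o a) (fun u => exponents u *m action_mx a)).
- by move=> v w /=; rewrite autM exponentsM.
- by move=> v w /=; rewrite exponentsM mulmxDl.
by move=> k /=; rewrite exponents_gen -rowE rowK.
Qed.

Definition nil_part a := action_mx a - 1%:M.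

Lemma nil_part1 : nil_part 1%g = 0.
Proof.
apply/eqP; rewrite subr_eq0; apply/eqP/row_matrixP => k.
by rewrite rowK row1 /= exponents_gen.
Qed.

(** The last product is in reverse order because [action_mx] acts on row
    vectors. *)
Lemma nil_partM a b :
  nil_part (a * b)%g = nil_part a + nil_part b + nil_part b *m nil_part a.
Proof.
have -> : nil_part (a * b)%g = action_mx b *m action_mx a - 1%:M.
  congr (_ - _); apply/row_matrixP => k.
  by rewrite row_mul !rowK -exponents_aut.
have action_mxE c : action_mx c = nil_part c + 1%:M by rewrite subrK.
rewrite !action_mxE mulmxDl !mulmxDr !mul1mx !mulmx1 addrA addrK -addrA addrC.
by rewrite (addrC (nil_part b)).
Qed.

Lemma nil_part_d (i j : 'I_n) (lt_ji : (j < i)%N) :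
  nil_part (d_aut lt_ji) = delta_mx i j.
Proof.
apply/row_matrixP => k.
rewrite linearB /= rowK row1 d_autE rowE mul_delta_mx_cond.
case: eqP => [->|_]; last by rewrite exponents_gen subrr.
by rewrite exponentsM !exponents_gen addrAC subrr add0r mulr1n.
Qed.

Lemma nil_part_dV (i j : 'I_n) (lt_ji : (j < i)%N) :
  nil_part (d_aut lt_ji)^-1%g = - delta_mx i j.
Proof.
apply/row_matrixP => k.
rewrite linearB linearN /= rowK row1 rowE mul_delta_mx_cond.
rewrite /= /d_inv free_lift_gen; case: eqP => [->|_].
  by rewrite exponentsM exponentsV !exponents_gen addrAC subrr add0r mulr1n.
by rewrite exponents_gen subrr oppr0.
Qed.

Definition strictly_lower (A : 'M[int]_n) :=
  forall i j : 'I_n, (i <= j)%N -> A i j = 0.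

(** A product of two strictly lower triangular matrices also vanishes on the
    subdiagonal [i = j + 1], which is why the subdiagonal is additive. *)
Lemma strictly_lower_mul A B (i j : 'I_n) :
  strictly_lower A -> strictly_lower B -> (i <= j.+1)%N -> (A *m B) i j = 0.
Proof.
move=> lA lB le_ij; rewrite mxE big1 // => k _.
have [le_ik|lt_ki] := leqP i k; first by rewrite lA ?mul0r.
by rewrite lB ?mulr0 // -ltnS (leq_trans lt_ki).
Qed.

Lemma strictly_lower_nil_partM a b :
  strictly_lower (nil_part a) -> strictly_lower (nil_part b) ->
  strictly_lower (nil_part (a * b)%g).
Proof.
move=> la lb i j le_ij; rewrite nil_partM mxE strictly_lower_mul ?(leqW le_ij) //.
by rewrite mxE la ?lb // !addr0.
Qed.

Lemma strictly_lower_D a : @D n a -> strictly_lower (nil_part a).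
Proof.
(* Carrying the inverse along makes the property closed under division. *)
suff ind : D a -> strictly_lower (nil_part a) /\ strictly_lower (nil_part a^-1%g).
  by case/ind.
elim/generated_ind: a / => [|a b [la laV] [lb lbV]|_ [i [j [lt_ji ->]]]].
- by rewrite invg1 nil_part1; split=> i j _; rewrite mxE.
- by rewrite invgM invgK; split; apply: strictly_lower_nil_partM.
rewrite nil_part_dV nil_part_d.
suff ld : strictly_lower (delta_mx i j).
  by split=> // k l le_kl; rewrite mxE ld ?oppr0.
move=> k l le_kl; rewrite mxE; case: eqP => //= ki; case: eqP => // lj.
by move: le_kl; rewrite ki lj leqNgt lt_ji.
Qed.

(** * Generation by consecutive transvections *)

(** Conjugating [x_i -> x_i x_j] by [x_j -> x_j x_k] gives [x_i -> x_i x_j x_k],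
    which is [d_{i,j} d_{i,k}]. *)
Lemma d_commutator (i j k : 'I_n)
    (lt_kj : (k < j)%N) (lt_ji : (j < i)%N) (lt_ki : (k < i)%N) :
  d_aut lt_ki =
    ((d_aut lt_ji)^-1 * d_aut lt_kj * d_aut lt_ji * (d_aut lt_kj)^-1)%g.
Proof.
suff eq_d :
    (d_aut lt_ji * d_aut lt_ki * d_aut lt_kj = d_aut lt_kj * d_aut lt_ji)%g.
  rewrite -[in RHS]mulgA -[in RHS]mulgA [X in (_^-1 * X)%g]mulgA.
  by rewrite -eq_d mulgK mulKg.
have [ki kj ji] : [/\ (k == i) = false, (k == j) = false & (j == i) = false].
  by split; apply: ltn_eqF.
have ij : (i == j) = false by rewrite eq_sym.
apply: aut_eq; apply: free_hom_eq => [||l]; try exact: autM.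
change (d_aut lt_ji (d_aut lt_ki (d_aut lt_kj (x l))) =
        d_aut lt_kj (d_aut lt_ji (x l))).
have E := (d_autE, autM, eqxx, ki, kj, ji, ij).
have [->|lj] := eqVneq l j; first by do 6 rewrite ?E //.
have [->|li] := eqVneq l i; first by do 8 rewrite ?E //=; rewrite mulgA.
by rewrite !(d_autE, negPf lj, negPf li).
Qed.

(** Induction on [i]: when [j + 1 < i], [d_commutator] with [i - 1] in the middle
    reduces [d_{i,j}] to [d_{i,i-1}], which is consecutive, and [d_{i-1,j}]. *)
Lemma consecutive_generate : generates_D (@d_consecutive n).
Proof.
apply/seteqP; split.
  by apply: sub_smallest2r => [|_ [i [j [lt_ji [_ ->]]]]];
    [apply: generated_closed|exists i, j, lt_ji].
apply: generated_min => [|_ [i [j [lt_ji ->]]]]; first exact: generated_closed.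
have [k] := ubnP i; elim: k i lt_ji => // k IHk i lt_ji lt_ik.
have [ij|ij] := eqVneq (i : nat) j.+1.
  by apply: sub_gen_smallest; exists i, j, lt_ji.
have lt_jpi : (j < i.-1)%N by rewrite ltn_predRL ltn_neqAle eq_sym ij.
have i_gt0 : (0 < i)%N by apply: leq_ltn_trans lt_ji.
have lt_in : (i.-1 < n)%N by rewrite (leq_ltn_trans (leq_pred _)).
pose i' := Ordinal lt_in.
have lt_i'i : (i' < i)%N by rewrite /= prednK.
have gi : generated (@d_consecutive n) (d_aut lt_i'i).
  by apply: sub_gen_smallest; exists i, i', lt_i'i; rewrite /= prednK.
have gj : generated (@d_consecutive n) (@d_aut _ i' j lt_jpi).
  by apply: IHk; rewrite (leq_trans lt_i'i) // -ltnS.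
rewrite (@d_commutator i i' j lt_jpi lt_i'i).
apply: generatedM (generatedV gj); apply: generatedM => //.
exact: generatedM (generatedV gi) gj.
Qed.

End FreeGroupAction.

(** * The subdiagonal homomorphism *)

Lemma d_aut_irr n (i i' j j' : 'I_n)
    (lt_ji : (j < i)%N) (lt_ji' : (j' < i')%N) :
  i = i' -> j = j' -> d_aut lt_ji = d_aut lt_ji'.
Proof.
by move=> ii jj; subst i' j'; rewrite (bool_irrelevance lt_ji lt_ji').
Qed.

Section Subdiagonal.
Variable m : nat.

(** [lift ord0 i] has value [i + 1] and [widen_ord _ i] has value [i]. *)
Definition consecutive (i : 'I_m) : aut (free_group 'I_m.+1) :=
  @d_aut _ (lift ord0 i) (widen_ord (leqnSn m) i) (leqnn i.+1).

Lemma d_consecutiveE : @d_consecutive m.+1 = range consecutive.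
Proof.
apply/seteqP; split=> [_ [i [j [lt_ji [ij ->]]]]|_ [i _ <-]].
  have lt_jm : (j < m)%N by rewrite -ltnS -ij.
  exists (Ordinal lt_jm) => //.
  by apply: d_aut_irr; apply: val_inj; rewrite /= ?ij.
by exists (lift ord0 i), (widen_ord (leqnSn m) i), (leqnn i.+1).
Qed.

Definition subdiag (a : D_group m.+1) : 'rV[int]_m :=
  \row_i nil_part (val a) (lift ord0 i) (widen_ord (leqnSn m) i).

Lemma subdiagE a i :
  subdiag a 0 i = nil_part (val a) (lift ord0 i) (widen_ord (leqnSn m) i).
Proof. exact: mxE. Qed.

Lemma subdiagM a b : subdiag (a * b)%g = subdiag a + subdiag b.
Proof.
apply/rowP => i.
rewrite [RHS]mxE !subdiagE [val _]/(val a * val b)%g nil_partM.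
rewrite [LHS]mxE [X in X + _ = _]mxE strictly_lower_mul ?addr0 //;
  by apply: strictly_lower_D; apply/set_mem/valP.
Qed.

Lemma consecutive_in_D i : consecutive i \in @D m.+1.
Proof.
rewrite inE; apply: sub_gen_smallest.
by exists (lift ord0 i), (widen_ord (leqnSn m) i), (leqnn i.+1).
Qed.

Definition consecutive_gen (i : 'I_m) : D_group m.+1 :=
  SigSub (consecutive_in_D i).

Lemma subdiag_gen i : subdiag (consecutive_gen i) = delta_mx 0 i.
Proof.
apply/rowP => k.
rewrite subdiagE nil_part_d [LHS]mxE [RHS]mxE eqxx (inj_eq lift_inj).
by rewrite -(inj_eq val_inj) /= (inj_eq val_inj) andbb.
Qed.

Lemma generated_consecutive_gen : generated (range consecutive_gen) = setT.
Proof.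
rewrite -(generated_preimage (@consecutive_generate m.+1)); congr generated.
apply/seteqP; split=> [_ [i _ <-]|a]; rewrite /= d_consecutiveE.
  by exists i.
by case=> i _ ia; exists i => //; apply: val_inj.
Qed.

End Subdiagonal.

Theorem corollary1 (n : nat) (n_ge2 : (2 <= n)%N) :
  isomorphic (abelianization (D_group n)) (Algebra.to_multiplicative 'rV[int]_(n.-1)) /\
  (forall S : set (aut (free_group 'I_n)), generates_D S -> `I_(n.-1) #<= S) /\
  (generates_D (@d_consecutive n) /\
   forall S : set (aut (free_group 'I_n)), generates_D S -> @d_consecutive n #<= S).
Proof.
case: n n_ge2 => // m _; rewrite [m.+1.-1]/=.
have bound S : @generates_D m.+1 S -> `I_m #<= S.
  move=> genS; apply: (card_le_trans (generators_card
    (@subdiagM m) (@subdiag_gen m) (generated_preimage genS))).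
  by apply: card_ge_preimage => a b _ _; apply: val_inj.
split; first exact: abelianization_free (@subdiagM m) (@subdiag_gen m)
  (@generated_consecutive_gen m).
split=> //; split=> [|S /bound]; first exact: consecutive_generate.
apply: card_le_trans; rewrite d_consecutiveE.
by apply: card_le_trans (card_image_le _ _) _; rewrite (card_le_eqr card_II).
Qed.
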